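(* For every constant $\varrho_0>0$ the Vlasov--Fokker--Planck equation $$\partial_t f + y^1\cdot\nabla_x f = \mathcal L[\rho[f]] f \qquad (x\in\Omega,\ \mathbf y\in\mathbb R^{dK})$$ admits the spatially homogeneous steady state $f_0(x,\mathbf y)=\varrho_0 M_0(\mathbf y)$ with $$M_0(\mathbf y)=\frac{1}{(2\pi)^{dK/2}(\det\Sigma)^{d/2}}\exp\Big(-\frac12\sum_{\ell=1}^d \mathbf y_\ell^T\Sigma^{-1}\mathbf y_\ell\Big),$$ where the covariance matrix $\Sigma\in\mathbb R^{K\times K}$ is $$\Sigma=g_0^2\int_0^\infty e^{tA}e_Ke_K^Te^{tA^T}\,dt,\qquad g_0:=G(\varrho_0)>0 .$$ In the special case $\alpha_k=\alpha>0$ for all $k\in\{1,\dots,K\}$, this evaluates to $$\Sigma_{ij}=g_0^2\,\frac{(2K-i-j)!}{(K-i)!\,(K-j)!\,(2\alpha)^{2K-i-j+1}}\qquad\text{for } i,j\in\{1,\dots,K\}.$$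
   Context: $d\ge1$, $K\ge1$ are integers; $\Omega=(0,1)^d$ is the $d$-dimensional torus. $\mathbf y=(y^1,\dots,y^K)\in\mathbb R^{dK}$ with $y^k\in\mathbb R^d$; for $\ell\in\{1,\dots,d\}$, $\mathbf y_\ell=(y^1_\ell,\dots,y^K_\ell)^T\in\mathbb R^K$. $\alpha_1,\dots,\alpha_K>0$ are constants and $A\in\mathbb R^{K\times K}$ is the upper bidiagonal matrix with $A_{kk}=-\alpha_k$ for $1\le k\le K$, $A_{k,k+1}=1$ for $1\le k\le K-1$, and all other entries zero. $e_K=(0,\dots,0,1)^T\in\mathbb R^K$. The response function $G:\mathbb R^+\to\mathbb R^+$ is bounded, positive and decreasing. The sensing kernel $W$ is nonnegative, bounded, radially symmetric, nonincreasing in $|x|$, compactly supported, periodically extended to $\Omega$, with $\int_\Omega W\,dx=1$. The density is $\rho[f](t,x)=\int_{\mathbb R^{dK}}f(t,x,\mathbf y)\,d\mathbf y$, and $W\ast\varrho$ is convolution on the torus. The operator is $$\mathcal L[\varrho]f=-\nabla_{\mathbf y}\cdot(A\mathbf y f)+\frac{G(W\ast\varrho)^2}{2}\Delta_{y^K}f,$$ where $A\mathbf y$ acts componentwise in $\ell$, i.e. $(A\mathbf y)_\ell=A\mathbf y_\ell$. *)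

(* Defs.v *)
From HB Require Import structures.
From mathcomp Require Import all_boot all_order all_algebra.
From mathcomp Require Import all_classical all_reals all_analysis.

Set Implicit Arguments.
Unset Strict Implicit.
Unset Printing Implicit Defensive.
Import Order.TTheory GRing.Theory Num.Theory.
Import numFieldNormedType.Exports.
Local Open Scope classical_set_scope.
Local Open Scope ring_scope.

Section LebesgueTuple.
Context {R : realType}.

Definition cons_pair n (p : measurableTypeR R * n.-tuple (measurableTypeR R)) :
    n.+1.-tuple (measurableTypeR R) :=
  [tuple of p.1 :: p.2].

Lemma measurable_cons_pair n : measurable_fun [set: _] (@cons_pair n).
Proof. exact: measurable_cons. Qed.

Section step.
Variables (n : nat)
  (mu : {sigma_finite_measure set (n.-tuple (measurableTypeR R)) -> \bar R}).

Definition lebesgue_tuple_step :=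
  pushforward (lebesgue_measure \x mu)%E (@cons_pair n).

Let step_preimage (A : set (n.+1.-tuple (measurableTypeR R))) :
  measurable A -> measurable (@cons_pair n @^-1` A).
Proof.
by move=> mA; rewrite -[X in measurable X]setTI; exact: measurable_cons_pair.
Qed.

Let step0 : lebesgue_tuple_step set0 = 0%E.
Proof. by rewrite /lebesgue_tuple_step /pushforward preimage_set0 measure0. Qed.

Let step_ge0 A : (0 <= lebesgue_tuple_step A)%E.
Proof. by rewrite /lebesgue_tuple_step /pushforward; exact: measure_ge0. Qed.

Let step_sigma_additive : semi_sigma_additive lebesgue_tuple_step.
Proof.
move=> F mF tF mUF; rewrite /lebesgue_tuple_step /pushforward preimage_bigcup.
apply: measure_semi_sigma_additive.
- by move=> i; exact: step_preimage.
- apply/trivIsetP => /= i j _ _ ij; rewrite -preimage_setI.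
  by move/trivIsetP : tF => /(_ _ _ _ _ ij) ->//; rewrite preimage_set0.
- by rewrite -preimage_bigcup; exact: step_preimage.
Qed.

HB.instance Definition _ := isMeasure.Build _ _ _
  lebesgue_tuple_step step0 step_ge0 step_sigma_additive.

Let step_sigma_finite : sigma_finite setT lebesgue_tuple_step.
Proof.
have /sigma_finiteP[F [FT ndF Foo]] := sigma_finiteT (@lebesgue_measure R).
have /sigma_finiteP[G [GT ndG Goo]] := sigma_finiteT mu.
pose u (v : n.+1.-tuple (measurableTypeR R)) :
    measurableTypeR R * n.-tuple (measurableTypeR R) :=
  (thead v, [tuple of behead v]).
have mu_ : measurable_fun setT u.
  apply/measurable_fun_pair => /=.
    exact: measurable_tnth.
  exact: measurable_behead.
have uK : u \o @cons_pair n = id.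
  apply/funext => p; rewrite /comp.
  by case: p => a b; rewrite /u /cons_pair/= theadE; congr pair; exact: val_inj.
exists (fun i => u @^-1` (F i `*` G i)).
  apply/seteqP; split => // v _.
  have [i _ Fi] : (\bigcup_i F i) (u v).1 by rewrite -FT.
  have [j _ Gj] : (\bigcup_i G i) (u v).2 by rewrite -GT.
  exists (maxn i j) => //; split.
  - by move: Fi; exact/subsetPset/ndF/leq_maxl.
  - by move: Gj; exact/subsetPset/ndG/leq_maxr.
move=> i; have [mF Fi] := Foo i; have [mG Gi] := Goo i; split.
  by rewrite -[X in measurable X]setTI; apply: mu_ => //; exact: measurableX.
rewrite /lebesgue_tuple_step /pushforward.
have -> : @cons_pair n @^-1` (u @^-1` (F i `*` G i)) = F i `*` G i.
  by rewrite -comp_preimage uK preimage_id.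
by rewrite product_measure1E// lte_mul_pinfty// ge0_fin_numE.
Qed.

HB.instance Definition _ := @Measure_isSigmaFinite.Build _ _ _
  lebesgue_tuple_step step_sigma_finite.

End step.

(* n-dimensional Lebesgue measure (on the Borel sets), built as the iterated
   product of the one-dimensional one; in dimension 0 it is the unit mass. *)
Fixpoint lebesgue_tuple (n : nat) :
    {sigma_finite_measure set (n.-tuple (measurableTypeR R)) -> \bar R} :=
  match n with
  | 0 => \d_ ([tuple] : 0.-tuple (measurableTypeR R))
  | m.+1 => lebesgue_tuple_step (lebesgue_tuple m)
  end.

End LebesgueTuple.

Section Model.
Context {R : realType}.

(* Reads the m * n coordinates of a tuple as an m x n matrix, row by row:
   'M[R]_(m, n) carries no measurable structure, so functions on it are
   integrated on tuples. *)
Definition mx_of_tuple m n (t : (m * n).-tuple (measurableTypeR R)) :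
    'M[R]_(m, n) :=
  vec_mx (\row_i tnth t i).

Definition row_of_tuple n (t : n.-tuple (measurableTypeR R)) : 'rV[R]_n :=
  \row_i tnth t i.

(* Euclidean norm: the norm `|x| of 'rV[R]_n is the sup norm. *)
Definition enorm n (x : 'rV[R]_n) : R := Num.sqrt (\sum_i x 0 i ^+ 2).

(* Functions on the torus (0, 1)^d are the functions on R^d that are 1-periodic
   in each coordinate. *)
Definition torus_fun d (h : 'rV[R]_d -> R) :=
  forall (k : 'rV[int]_d) x, h (x + map_mx intr k) = h x.

Definition Omega d : set (d.-tuple (measurableTypeR R)) :=
  [set t | forall i, tnth t i \in `]0, 1[%R].

(* Periodic extension of a kernel on R^d; the sum over Z^d is finite when W has
   compact support, and on the cell ]-1/2, 1/2[^d it is W itself when W is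
   supported there. *)
Definition periodize d (W : 'rV[R]_d -> R) (x : 'rV[R]_d) : R :=
  \sum_(k \in [set: 'rV[int]_d]) W (x + map_mx intr k).

Definition torus_conv d (W h : 'rV[R]_d -> R) (x : 'rV[R]_d) : R :=
  Rintegral (lebesgue_tuple d) (@Omega d)
    (fun z => W (row_of_tuple z) * h (x - row_of_tuple z)).

Record response_function (G : R -> R) : Prop := {
  response_bounded : exists C, forall s, 0 <= s -> G s <= C ;
  response_gt0 : forall s, 0 <= s -> 0 < G s ;
  response_decreasing : forall s s', 0 <= s -> s <= s' -> G s' <= G s }.

Record sensing_kernel d (W : 'rV[R]_d -> R) : Prop := {
  kernel_ge0 : forall x, 0 <= W x ;
  kernel_bounded : exists C, forall x, W x <= C ;
  kernel_radial : forall x x', enorm x = enorm x' -> W x = W x' ;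
  kernel_nonincreasing : forall x x', enorm x <= enorm x' -> W x' <= W x ;
  kernel_compact_support : compact (closure [set x | W x != 0]) ;
  kernel_integrable : (lebesgue_tuple d).-integrable (@Omega d)
    (fun z => (periodize W (row_of_tuple z))%:E) ;
  kernel_mass1 : Rintegral (lebesgue_tuple d) (@Omega d)
    (fun z => periodize W (row_of_tuple z)) = 1 }.

Section VlasovFokkerPlanck.
(* y : 'M[R]_(K, d) has row k equal to y^k and column l equal to y_l, so that
   A y is the matrix product A *m y. The indices are 0-based: y^1 is row
   idx_first hK and y^K is row idx_last hK. *)
Variables (d K : nat) (hK : (0 < K)%N).

Definition idx_first : 'I_K := Ordinal hK.
Definition idx_last : 'I_K := rev_ord idx_first.

Definition density (g : 'M[R]_(K, d) -> R) : R :=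
  Rintegral (lebesgue_tuple (K * d)) setT (fun t => g (mx_of_tuple t)).

Variables (A : 'M[R]_K) (G : R -> R) (W : 'rV[R]_d -> R).

Definition VFP_operator (rho : 'rV[R]_d -> R)
    (f : 'rV[R]_d -> 'M[R]_(K, d) -> R) (x : 'rV[R]_d) (y : 'M[R]_(K, d)) : R :=
  - (\sum_(k < K) \sum_(l < d)
       'D_(delta_mx k l) (fun z => (A *m z) k l * f x z) y)
  + G (torus_conv W rho x) ^+ 2 / 2 *
    \sum_(l < d) 'D_(delta_mx idx_last l) ('D_(delta_mx idx_last l) (f x)) y.

(* Since Rintegral and 'D_v are total, the existence of every integral and
   derivative occurring in the equation is required separately. *)
Record VFP_solution (f : R -> 'rV[R]_d -> 'M[R]_(K, d) -> R) : Prop := {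
  sol_periodic : forall t y, 0 < t -> torus_fun (fun x => f t x y) ;
  sol_density : forall t x, 0 < t ->
    (lebesgue_tuple (K * d)).-integrable setT
      (fun u => (f t x (mx_of_tuple u))%:E) ;
  sol_conv : forall t x, 0 < t ->
    (lebesgue_tuple d).-integrable (@Omega d)
      (fun z => (W (row_of_tuple z) * density (f t (x - row_of_tuple z)))%:E) ;
  sol_derivable_t : forall t x y, 0 < t -> derivable (fun s => f s x y) t 1 ;
  sol_derivable_x : forall t x y l, 0 < t ->
    derivable (fun z => f t z y) x (delta_mx 0 l) ;
  sol_derivable_drift : forall t x y k l, 0 < t ->
    derivable (fun z => (A *m z) k l * f t x z) y (delta_mx k l) ;
  sol_derivable_y : forall t x y l, 0 < t ->
    derivable (f t x) y (delta_mx idx_last l) ;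
  sol_derivable_yy : forall t x y l, 0 < t ->
    derivable ('D_(delta_mx idx_last l) (f t x)) y (delta_mx idx_last l) ;
  sol_equation : forall t x y, 0 < t ->
    'D_1 (fun s => f s x y) t
    + \sum_(l < d) y idx_first l * 'D_(delta_mx 0 l) (fun z => f t z y) x
    = VFP_operator (fun z => density (f t z)) (f t) x y }.

Definition steady_state (f : 'rV[R]_d -> 'M[R]_(K, d) -> R) :=
  VFP_solution (fun _ => f).

End VlasovFokkerPlanck.

Definition drift_mx K (alpha : 'I_K -> R) : 'M[R]_K :=
  \matrix_(i, j) if j == i then - alpha i else (j == i.+1 :> nat)%:R.

Definition expmx n (B : 'M[R]_n) : 'M[R]_n :=
  limn (series (fun k => k`!%:R^-1 *: B ^+ k)).

Definition covariance_integrand K (hK : (0 < K)%N) (A : 'M[R]_K) (t : R) :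
    'M[R]_K :=
  let e_K : 'cV[R]_K := delta_mx (idx_last hK) 0 in
  expmx (t *: A) *m e_K *m e_K^T *m expmx (t *: A^T).

Definition covariance_mx K (hK : (0 < K)%N) (A : 'M[R]_K) (g0 : R) : 'M[R]_K :=
  g0 ^+ 2 *: \matrix_(i, j)
    Rintegral lebesgue_measure `[0, +oo[%classic
      (fun t => covariance_integrand hK A t i j).

Definition gaussian K d (Sigma : 'M[R]_K) (y : 'M[R]_(K, d)) : R :=
  ((2 * pi) `^ ((d * K)%:R / 2) * \det Sigma `^ (d%:R / 2))^-1
  * expR (- (1 / 2) *
      \sum_(l < d) ((col l y)^T *m invmx Sigma *m col l y) 0 0).

End Model.

(* Main.v *)
(** Write [u t := expmx (t *: A) *m e_K], so that [u' = A u] and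
    [Sigma = g0^2 * \int u u^T]. By back substitution along the bidiagonal [A],
    [u] decays exponentially; integrating [(u u^T)'] over the half-line gives the
    Lyapunov equation [A Sigma + Sigma A^T = - g0^2 e_K e_K^T], and everything
    else follows from it by algebra. [Sigma] is positive semidefinite, and its
    kernel is invariant under [A^T] and orthogonal to [e_K], hence trivial. The
    two terms of the operator applied to the Gaussian cancel because of the trace
    and the quadratic form of the Lyapunov equation multiplied by [Sigma^-1]. For
    equal rates the entries of the Lyapunov equation are Pascal's recursion, with
    the binomial formula as the unique solution. That the Gaussian has mass one is
    proved by completing the square in one variable at a time, which replaces the
    quadratic form by a Schur complement. *)

Require Import Defs.
From mathcomp Require Import all_boot all_order all_algebra.
From mathcomp Require Import all_classical all_reals all_analysis.
From mathcomp Require Import perm measurable_realfun mxtens zify ring lra.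

Import Order.TTheory GRing.Theory Num.Theory.
Import numFieldNormedType.Exports.
Local Open Scope classical_set_scope.
Local Open Scope ring_scope.

Set Implicit Arguments.
Unset Strict Implicit.
Unset Printing Implicit Defensive.

(** * Gaussian integrals *)

Definition qform (R : pzRingType) n (Q : 'M[R]_n) (v : 'rV[R]_n) : R :=
  (v *m Q *m v^T) 0 0.

Definition posdef (R : numDomainType) n (Q : 'M[R]_n) : Prop :=
  Q^T = Q /\ forall v, v != 0 -> 0 < qform Q v.

Section SchurComplement.
Context {R : realFieldType} {n : nat}.
Variable Q : 'M[R]_(1 + n).

Let a := Q 0 0.
Let b : 'rV[R]_n := ursubmx Q.

Definition schur : 'M[R]_n := drsubmx Q - a^-1 *: (b^T *m b).

Hypothesis Qpd : posdef Q.

Lemma posdef_corner_gt0 : 0 < a.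
Proof.
have := Qpd.2 (delta_mx 0 0); rewrite /qform -rowE trmx_delta -colE !mxE; apply.
by apply/eqP => /matrixP /(_ 0 0); rewrite !mxE !eqxx => /eqP; rewrite oner_eq0.
Qed.

Lemma posdef_blockE :
  Q = block_mx a%:M b b^T (drsubmx Q) /\ (drsubmx Q)^T = drsubmx Q.
Proof.
have sQ : Q^T = Q := Qpd.1.
have da : ulsubmx Q = a%:M.
  by apply/matrixP=> i j; rewrite !ord1 !mxE eqxx mulr1n /a;
    congr (Q _ _); apply/val_inj.
split; last by rewrite trmx_drsub sQ.
by rewrite -[LHS]submxK da /b trmx_ursub sQ.
Qed.

(** One step of block Gaussian elimination; its triangular factors give the determinant in
    [det_schur]. *)
Lemma schur_factor :
  Q = block_mx 1%:M 0 (a^-1 *: b^T) 1%:M *m block_mx a%:M b 0 schur.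
Proof.
have a0 : a != 0 by rewrite gt_eqF// posdef_corner_gt0.
rewrite {1}posdef_blockE.1 mulmx_block !mul1mx !mul0mx !addr0.
by rewrite mul_mx_scalar scalerA mulfV// scale1r /schur -scalemxAl addrC subrK.
Qed.

(** Completing the square in the first coordinate: the cross terms are absorbed into the shift of
    [x]. *)
Lemma qform_schur (x : R) (v : 'rV[R]_n) :
  qform Q (row_mx x%:M v) =
  a * (x + a^-1 * (b *m v^T) 0 0) ^+ 2 + qform schur v.
Proof.
have a0 : a != 0 by rewrite gt_eqF// posdef_corner_gt0.
have bvT : (v *m b^T) = (b *m v^T)^T by rewrite trmx_mul trmxK.
rewrite /qform {1}posdef_blockE.1 mul_row_block tr_row_mx mul_row_col.
rewrite /schur mulmxBr mulmxBl -scalemxAr -scalemxAl mulmxA -[in RHS](mulmxA _ b).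
rewrite !mulmxDl bvT !mul_scalar_mx tr_scalar_mx !mul_mx_scalar -!scalemxAl.
set q := v *m _ *m _; set s := b *m v^T; rewrite [s]mx11_scalar; set t := s 0 0.
rewrite tr_scalar_mx mul_scalar_mx; move: q t => q t.
rewrite !mxE eqxx !mulr1n; field.
exact: a0.
Qed.

(** For positivity, the first coordinate is chosen so that the square in [qform_schur] vanishes,
    which leaves only the form of [schur]. *)
Lemma schur_posdef : posdef schur.
Proof.
split.
  by rewrite /schur linearB/= linearZ/= trmx_mul trmxK posdef_blockE.2.
move=> v v0; have := Qpd.2 (row_mx (- (a^-1 * (b *m v^T) 0 0))%:M v).
rewrite qform_schur addNr expr0n mulr0 add0r; apply.
apply: contraNneq v0 => /(congr1 rsubmx); rewrite row_mxKr => ->.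
by rewrite linear0.
Qed.

Lemma det_schur : \det Q = a * \det schur.
Proof.
rewrite schur_factor det_mulmx det_lblock !det1 !mul1r.
by rewrite det_ublock det_scalar1.
Qed.

End SchurComplement.

Lemma posdef_det_gt0 (R : realFieldType) n (Q : 'M[R]_n) : posdef Q -> 0 < \det Q.
Proof.
elim: n Q => [|n IHn] Q Qpd; first by rewrite det_mx00 ltr01.
rewrite (@det_schur _ n)// mulr_gt0 ?(posdef_corner_gt0 (n := n))//.
by apply: IHn; exact: schur_posdef.
Qed.

Section GaussianIntegral.
Context {R : realType}.
Local Notation mu := (@lebesgue_measure R).

Lemma measurable_qform n (Q : 'M[R]_n) :
  measurable_fun [set: n.-tuple (measurableTypeR R)]
    (fun t => qform Q (row_of_tuple t)).
Proof.
under eq_fun do rewrite /qform mxE.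
apply: measurable_sum => i; apply: measurable_funM; last first.
  by under eq_fun do rewrite !mxE; exact: measurable_tnth.
under eq_fun do rewrite mxE.
apply: measurable_sum => j; apply: measurable_funM => //.
by under eq_fun do rewrite !mxE; exact: measurable_tnth.
Qed.

Lemma measurable_gaussian n (Q : 'M[R]_n) :
  measurable_fun [set: n.-tuple (measurableTypeR R)]
    (fun t => (expR (- (1 / 2) * qform Q (row_of_tuple t)))%:E).
Proof.
apply/measurable_EFinP; apply: measurableT_comp => //.
by apply: measurable_funM => //; exact: measurable_qform.
Qed.

(** Up to its peak value, the integrand is the normal density with mean [- m] and variance
    [a^-1]. *)
Lemma integral_gaussian1 (a m : R) : 0 < a ->
  (\int[mu]_x (expR (- (1 / 2) * (a * (x + m) ^+ 2)))%:E =
   (Num.sqrt (2 * pi / a))%:E)%E.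
Proof.
move=> a0; pose s := Num.sqrt a^-1.
have s2 : s ^+ 2 = a^-1 by rewrite sqr_sqrtr// invr_ge0 ltW.
have s0 : s != 0 by rewrite gt_eqF// sqrtr_gt0 invr_gt0.
have p0 : normal_peak s != 0 by rewrite gt_eqF// normal_peak_gt0.
transitivity (\int[mu]_x ((normal_peak s)^-1%:E * (normal_pdf (- m) s x)%:E))%E.
  apply: eq_integral => x _; rewrite -EFinM normal_pdfE// mulKf// /normal_fun.
  rewrite opprK s2; congr (expR _)%:E.
  by field; rewrite gt_eqF.
rewrite integralZl//; last exact: integrable_normal_pdf.
rewrite integral_normal_pdf mule1 /normal_peak invrK s2; congr (Num.sqrt _)%:E.
by field; rewrite gt_eqF.
Qed.

Lemma row_of_tuple_cons n x (w : n.-tuple (measurableTypeR R)) :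
  row_of_tuple (cons_pair (x, w)) = row_mx x%:M (row_of_tuple w) :> 'rV_(1 + n).
Proof.
apply/rowP => i; rewrite !mxE (tnth_nth 0); case: splitP => j ij.
  by rewrite ij [j]ord1 !mxE.
by rewrite ij /= !mxE (tnth_nth 0).
Qed.

(** Tonelli's theorem integrates out the first coordinate; [schur_posdef] and [det_schur] carry the
    induction on the dimension. *)
Lemma integral_gaussian n (Q : 'M[R]_n) : posdef Q ->
  (\int[lebesgue_tuple n]_t (expR (- (1 / 2) * qform Q (row_of_tuple t)))%:E =
   (Num.sqrt ((2 * pi) ^+ n / \det Q))%:E)%E.
Proof.
elim: n Q => [|n IHn] Q Qpd.
  rewrite integral_dirac//; last exact: measurable_gaussian.
  rewrite diracT mul1e det_mx00 /qform thinmx0 mul0mx mxE.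
  by rewrite mulr0 expR0 expr0 divr1 sqrtr1.
have a0 := posdef_corner_gt0 (n := n) Qpd.
have Spd := schur_posdef (n := n) Qpd.
have S0 := posdef_det_gt0 Spd.
set f := fun t => _.
have mf : measurable_fun setT f by exact: measurable_gaussian.
have f0 t : (0 <= f t)%E by rewrite lee_fin expR_ge0.
rewrite [LHS](ge0_integral_pushforward (@measurable_cons_pair _ _))//.
rewrite preimage_setT fubini_tonelli2//; last 2 first.
- exact: (measurableT_comp mf (@measurable_cons_pair R n)).
- by move=> t; exact: f0.
pose g w := expR (- (1 / 2) * qform (schur (n := n) Q) (row_of_tuple w)).
have mE (c : R) : measurable_fun [set: measurableTypeR R]
    (fun x => (expR (- (1 / 2) * (Q 0 0 * (x + c) ^+ 2)))%:E).
  apply/measurable_EFinP; apply: measurableT_comp => //.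
  do 2 (apply: measurable_funM => //).
  by apply: measurable_funX; exact: measurable_funD.
have inner w : (\int[mu]_x f (cons_pair (x, w)) =
    (Num.sqrt (2 * pi / Q 0 0))%:E * (g w)%:E)%E.
  pose b := ursubmx (m1 := 1) (n1 := 1) Q.
  (* The shift depends on [w], but [integral_gaussian1] gives the same value for every shift. *)
  rewrite -(integral_gaussian1 ((Q 0 0)^-1 * (b *m (row_of_tuple w)^T) 0 0) a0).
  rewrite -ge0_integralZr ?lee_fin ?expR_ge0//.
  apply: eq_integral => x _.
  by rewrite /f row_of_tuple_cons (qform_schur Qpd) mulrDr expRD EFinM.
rewrite /fubini_G /= (eq_integral _ _ (fun w _ => inner w)).
rewrite ge0_integralZl ?lee_fin ?sqrtr_ge0//; last 2 first.
- exact: measurable_gaussian.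
- by move=> w _; rewrite lee_fin expR_ge0.
rewrite IHn// -EFinM -sqrtrM; last by rewrite !mulr_ge0 ?invr_ge0 ?pi_ge0 ?ltW.
congr (Num.sqrt _)%:E; rewrite (det_schur (n := n) Qpd) exprS; field.
by rewrite !gt_eqF.
Qed.

End GaussianIntegral.

(** * Determinant and quadratic form of left multiplication by a matrix *)

Lemma det_castmx (R : comPzRingType) m n (e e' : m = n) (A : 'M[R]_m) :
  \det (castmx (e, e') A) = \det A.
Proof. by subst n; rewrite (eq_irrelevance e' erefl) castmx_id. Qed.

(** Rows and columns undergo the same permutation, so its sign appears twice and cancels. *)
Lemma det_mxsub_bij (R : comPzRingType) m n (f : 'I_m -> 'I_n) (A : 'M[R]_n) :
  bijective f -> \det (mxsub f f A) = \det A.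
Proof.
move=> bf; have mn : m = n by rewrite -[LHS]card_ord -[RHS]card_ord (bij_eq_card bf).
subst m.
pose s := perm (bij_inj bf).
have -> : mxsub f f A = row_perm s (col_perm s A).
  by apply/matrixP => i j; rewrite !mxE !permE.
rewrite row_permE col_permE !det_mulmx !det_perm odd_permV mulrC -mulrA.
by rewrite -signr_addb addbb mulr1.
Qed.

(** With an identity as left factor, the tensor product is block diagonal with [d] copies of [P]. *)
Lemma det_tens1mx (R : comPzRingType) d n (P : 'M[R]_n) :
  \det (tensmx (1%:M : 'M[R]_d) P) = \det P ^+ d.
Proof.
elim: d => [|d IHd]; first by rewrite det_mx00.
rewrite -[X in tensmx X]/(1%:M : 'M[R]_(1 + d)) (scalar_mx_block 1 d 1).
rewrite tens_block_mx det_castmx !tens0mx det_ublock IHd exprS; congr (_ * _).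
by rewrite -[1%:M]/(1 : 'M[R]_1) tens_scalar1mx det_castmx.
Qed.

(* Up to a permutation of the coordinates, left multiplication by [P] is the
   tensor product of the identity with [P]. *)
Lemma det_lin_mulmx (R : comPzRingType) n d (P : 'M[R]_n) :
  \det (lin_mulmx P : 'M[R]_(n * d)) = \det P ^+ d.
Proof.
(* The tensor index encodes the pair (column, row) and [mxvec_index] the pair (row, column), so [f]
   swaps the two. *)
pose f (a : 'I_(d * n)) : 'I_(n * d) :=
  mxvec_index (mxtens_unindex a).2 (mxtens_unindex a).1.
have bf : bijective f.
  apply: inj_card_bij; last by rewrite !card_ord mulnC.
  have [g fK _] := curry_mxvec_bij n d.
  move=> a b /(congr1 g); rewrite /f.
  have gE i j : g (mxvec_index i j) = (i, j) by exact: (fK (i, j)).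
  rewrite !gE => ab; apply: (can_inj (@mxtens_unindexK d n)); move: ab.
  by move: (mxtens_unindex a) (mxtens_unindex b) => [? ?] [? ?] /= [-> ->].
(* The matrix of [lin_mulmx P] acts on row vectors, hence contains the transpose of [P]. *)
rewrite -(det_mxsub_bij _ bf) -det_tr -(det_tens1mx d P); congr (\det _).
apply/matrixP => a b; case: (mxtens_indexP a) => l k; case: (mxtens_indexP b) => l' k'.
rewrite tensmxE !mxE /f !mxtens_indexK /=.
rewrite vec_mx_delta mxvecE mxE (bigD1 k')//= big1 => [|i ik].
  by rewrite mxE eqxx addr0 mulrC.
by rewrite mxE (negbTE ik) mulr0.
Qed.

Lemma big_mxvec (R : nmodType) m n (F : 'I_(m * n) -> R) :
  \sum_a F a = \sum_i \sum_j F (mxvec_index i j).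
Proof.
by rewrite (reindex _ (curry_mxvec_bij m n)) pair_bigA; apply: eq_bigr => -[].
Qed.

(** Left multiplication acts on each column separately. The exponent of the Gaussian thus becomes a
    single quadratic form in all [n * d] coordinates. *)
Lemma qform_lin_mulmx (R : comPzRingType) n d (P : 'M[R]_n) (y : 'M[R]_(n, d)) :
  P^T = P ->
  qform (lin_mulmx P) (mxvec y) = \sum_(l < d) qform P (col l y)^T.
Proof.
move=> sP; rewrite /qform mul_vec_lin /= mxE.
rewrite big_mxvec exchange_big; apply: eq_bigr => l _.
rewrite trmxK !mxE; apply: eq_bigr => k _.
rewrite mxvecE !mxE mxvecE; congr (_ * _).
by apply: eq_bigr => j _; rewrite !mxE mulrC -{1}sP mxE.
Qed.

(** The form is a sum of nonnegative column forms; if it vanishes, so does every column. *)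
Lemma lin_mulmx_posdef (R : realFieldType) n d (P : 'M[R]_n) :
  posdef P -> posdef (lin_mulmx P : 'M[R]_(n * d)).
Proof.
move=> [sP Pgt0]; split.
  apply/matrixP => a b; case/mxvec_indexP: a => k l.
  case/mxvec_indexP: b => k' l'.
  rewrite !mxE /= !vec_mx_delta !mxvecE !mxE.
  rewrite (bigD1 k')//= big1 => [|i ik]; last by rewrite mxE (negbTE ik) mulr0.
  rewrite (bigD1 k)//= big1 => [|i ik]; last by rewrite mxE (negbTE ik) mulr0.
  by rewrite !mxE !eqxx !addr0 /= -{1}sP mxE [l == l']eq_sym.
move=> v v0; rewrite -[v]vec_mxK qform_lin_mulmx//.
have Pge0 u : 0 <= qform P u.
  have [->|/Pgt0/ltW//] := eqVneq u 0.
  by rewrite /qform !mul0mx mxE.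
rewrite lt_neqAle sumr_ge0// andbT eq_sym; apply: contraNN v0.
rewrite psumr_eq0// => /allP s0; rewrite -[v]vec_mxK; apply/eqP.
suff -> : vec_mx v = 0 by rewrite linear0.
apply/matrixP => k l; have := s0 l (mem_index_enum _).
have [/rowP /(_ k) + _|/Pgt0 + /eqP p0] := eqVneq (col l (vec_mx v))^T 0.
  by rewrite !mxE.
by rewrite p0 ltxx.
Qed.

Section GaussianDensity.
Context {R : realType}.
Variables (d K : nat) (P : 'M[R]_K).
Hypothesis Ppd : posdef P.

Lemma mx_of_tupleK (t : (K * d).-tuple (measurableTypeR R)) :
  mxvec (mx_of_tuple t) = row_of_tuple t.
Proof. by rewrite /mx_of_tuple vec_mxK. Qed.

Lemma integral_gaussian_mx :
  (\int[lebesgue_tuple (K * d)]_t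
    (expR (- (1 / 2) * \sum_(l < d) qform P (col l (mx_of_tuple t))^T))%:E =
   (Num.sqrt ((2 * pi) ^+ (K * d) / \det P ^+ d))%:E)%E.
Proof.
rewrite -det_lin_mulmx -(integral_gaussian (lin_mulmx_posdef d Ppd)).
by apply: eq_integral => t _; rewrite -mx_of_tupleK qform_lin_mulmx// Ppd.1.
Qed.

End GaussianDensity.
(** * Matrix exponential *)

Section ExponentialSeries.
Context {R : realType}.
Implicit Types (c : R^nat) (x : R).

(** Domination by the Taylor coefficients of an exponential, a condition that survives termwise
    differentiation and makes the radius of convergence infinite. *)
Definition exp_type c :=
  exists C M : R, 0 <= M /\ forall k, `|c k| <= C * (M ^+ k / k`!%:R).

Lemma exp_type_cvg c x : exp_type c -> cvgn (pseries c x).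
Proof.
move=> [C [M [M0 cM]]]; apply: normed_cvg.
apply: (@series_le_cvg _ _ (C *: exp_coeff (M * `|x|))) => [k|k|k|] /=.
- by rewrite normr_ge0.
- apply: (le_trans (normr_ge0 (c k * x ^+ k))).
  rewrite normrM normrX (le_trans (ler_wpM2r _ (cM k))) ?exprn_ge0//.
  by rewrite -[(_ *: _) k]/(C * (_ / _)) exprMn -mulrA -mulrAC mulrA.
- rewrite normrM normrX (le_trans (ler_wpM2r _ (cM k))) ?exprn_ge0//.
  by rewrite -[(_ *: _) k]/(C * (_ / _)) exprMn -mulrA -mulrAC mulrA.
- by apply: is_cvg_seriesZ; exact: is_cvg_series_exp_coeff.
Qed.

Lemma exp_type_diffs c : exp_type c -> exp_type (pseries_diffs c).
Proof.
move=> [C [M [M0 cM]]]; exists (C * M), M; split => // k.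
rewrite /pseries_diffs normrM ger0_norm//.
rewrite (le_trans (ler_wpM2l _ (cM k.+1)))//.
rewrite factS natrM exprS invfM.
rewrite le_eqVlt; apply/orP; left; apply/eqP; field.
by rewrite nat1r !pnatr_eq0 -lt0n fact_gt0.
Qed.

(** [pseries_snd_diffs] asks for convergence of the series and of its first two derived series at
    one point farther from the origin than [x]. *)
Lemma exp_type_is_derive c x : exp_type c ->
  is_derive x (1 : R) (fun x => limn (pseries c x))
    (limn (pseries (pseries_diffs c) x)).
Proof.
move=> hc; apply: (@pseries_snd_diffs _ c (`|x| + 1)).
- exact: exp_type_cvg.
- exact/exp_type_cvg/exp_type_diffs.
- by apply/exp_type_cvg; do 2 apply: exp_type_diffs.
- by rewrite [ltRHS]ger0_norm ?addr_ge0// ltrDl.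
Qed.

Lemma pseries_at0 c : limn (pseries c 0) = c 0%N.
Proof.
apply/cvg_lim => //; rewrite -(cvg_shiftS (pseries c 0)).
rewrite (_ : (fun n => _) = cst (c 0%N)); first exact: cvg_cst.
apply/funext => n /=; rewrite /pseries /series /= big_nat_recl// big1 ?addr0.
  by rewrite expr0 mulr1.
by move=> i _; rewrite expr0n mulr0.
Qed.

End ExponentialSeries.

Section MatrixExponential.
Context {R : realType} {n : nat}.
Implicit Type B : 'M[R]_n.

Definition expmx_coeff B i j : R^nat := fun k => (B ^+ k) i j / k`!%:R.

(** The sum [M] of the absolute values of all entries bounds each row sum of [B], hence by induction
    the entries of [B ^+ k] are bounded by [M ^+ k]. *)
Lemma expmx_coeff_type B i j : exp_type (expmx_coeff B i j).
Proof.
pose M := \sum_i \sum_j `|B i j|.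
have M0 : 0 <= M by do 2 (apply: sumr_ge0 => ? _).
have rowM a : \sum_b `|B a b| <= M.
  by rewrite /M [leRHS](bigD1 a)//= lerDl; do 2 (apply: sumr_ge0 => ? _).
exists 1, M; split=> // k.
rewrite mul1r /expmx_coeff normrM [`|_^-1|]ger0_norm ?invr_ge0//.
rewrite ler_wpM2r ?invr_ge0//.
elim: k i j => [|k IHk] i j.
  by rewrite !expr0 mxE; case: eqP => _; rewrite ?normr1// normr0.
rewrite exprS mxE (le_trans (ler_norm_sum _ _ _))//.
rewrite exprS (le_trans _ (ler_wpM2r _ (rowM i))) ?exprn_ge0//.
by rewrite mulr_suml ler_sum// => l _; rewrite normrM ler_wpM2l.
Qed.

(** There are finitely many entries, so their closeness conditions hold simultaneously along the
    filter. *)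
Lemma cvg_mx_entries (T : Type) (F : set_system T) {FF : Filter F} m p
    (f : T -> 'M[R]_(m, p)) (l : 'M[R]_(m, p)) :
  (forall i j, f x i j @[x --> F] --> l i j) -> f x @[x --> F] --> l.
Proof.
move=> fl; apply/cvg_mx_entourageP => A entA.
have : forall i j, \forall x \near F, (l i j, f x i j) \in A.
  move=> i j; have /cvg_entourageP/(_ _ entA) := fl i j.
  by apply: (@filterS _ F) => x /= Ax; exact: mem_set.
move=> H; apply: (@filterS _ F _ (fun x => forall i j, (l i j, f x i j) \in A)) => //.
by apply: filter_forall => i; exact: filter_forall.
Qed.

Lemma exprZmx B t k : (t *: B) ^+ k = t ^+ k *: B ^+ k.
Proof.
elim: k => [|k IHk]; first by rewrite !expr0 scale1r.
rewrite !exprS IHk [LHS](_ : _ = (t *: B) *m (t ^+ k *: B ^+ k))//.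
by rewrite -scalemxAl -scalemxAr scalerA.
Qed.

(** Each entry becomes a scalar power series in [t], to which termwise differentiation applies. *)
Lemma expmxE B t i j : expmx (t *: B) i j = limn (pseries (expmx_coeff B i j) t).
Proof.
pose L : 'M[R]_n := \matrix_(i, j) limn (pseries (expmx_coeff B i j) t).
suff -> : expmx (t *: B) = L by rewrite mxE.
apply/cvg_lim; first exact: norm_hausdorff.
apply: cvg_mx_entries => a b; rewrite mxE.
rewrite (_ : (fun x => _) = pseries (expmx_coeff B a b) t).
  exact/exp_type_cvg/expmx_coeff_type.
apply/funext => m; rewrite /pseries /series /= summxE; apply: eq_bigr => k _.
rewrite exprZmx !mxE /expmx_coeff; ring.
Qed.

Lemma expmx0 B : expmx (0 *: B) = 1%:M.
Proof.
by apply/matrixP => i j; rewrite expmxE pseries_at0 /expmx_coeff expr0 divr1.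
Qed.

(** The derived series has the entries of [B ^+ k.+1] over the factorial of [k] as coefficients; one
    factor [B] comes out on the left as a finite sum. *)
Lemma is_derive_expmx B t i j :
  is_derive t (1 : R) (fun t => expmx (t *: B) i j) ((B *m expmx (t *: B)) i j).
Proof.
under eq_fun do rewrite expmxE.
have -> : (B *m expmx (t *: B)) i j =
    limn (pseries (pseries_diffs (expmx_coeff B i j)) t).
  apply/esym/cvg_lim => //; rewrite mxE; under eq_bigr do rewrite expmxE.
  rewrite (_ : pseries _ _ = fun m => \sum_l B i l * pseries (expmx_coeff B l j) t m).
    apply: cvg_big => [|l _]; first exact: add_continuous.
    apply: cvgM; first exact: cvg_cst.
    exact/exp_type_cvg/expmx_coeff_type.
  apply/funext => m; rewrite /pseries /series /=.
  under [RHS]eq_bigr do rewrite mulr_sumr.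
  rewrite exchange_big; apply: eq_bigr => k _ /=.
  rewrite /pseries_diffs /expmx_coeff exprS mxE.
  rewrite mulr_suml mulr_sumr mulr_suml; apply: eq_bigr => l _.
  rewrite factS natrM; field.
  by rewrite nat1r !pnatr_eq0 -lt0n fact_gt0.
exact/exp_type_is_derive/expmx_coeff_type.
Qed.

Lemma trmx_expmx B t : (expmx (t *: B))^T = expmx (t *: B^T).
Proof.
apply/matrixP => i j; rewrite mxE !expmxE; congr (limn (pseries _ t)).
apply/funext => k; rewrite /expmx_coeff; congr (_ / _).
elim: k i j => [|k IHk] i j; first by rewrite !expr0 !mxE eq_sym.
rewrite exprSr exprS !mxE; apply: eq_bigr => l _.
by rewrite mxE mulrC IHk.
Qed.

End MatrixExponential.
(** * Integrals of exponentially decaying functions *)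

Section Decay.
Context {R : realType}.
Local Notation mu := (@lebesgue_measure R).
Implicit Types (v w F f : R -> R) (a b c t : R).

Lemma is_derive_expRM c t :
  is_derive t (1 : R) (fun s => expR (c * s)) (c * expR (c * t)).
Proof.
have dc : is_derive t (1 : R) ( *%R c) c.
  have := is_deriveZ c (is_derive_id t (1 : R)).
  by move/is_derive_eq; apply; rewrite /GRing.scale/= mulr1.
have := is_derive1_comp (is_derive_expR (c * t)) dc.
by move/is_derive_eq; apply; rewrite mulrC.
Qed.

Lemma continuous_is_derive F f :
  (forall t, is_derive t (1 : R) F (f t)) -> continuous F.
Proof.
move=> dF t; apply: differentiable_continuous; apply/derivable1_diffP.
by have [] := dF t.
Qed.

(** The integrating factor [expR (a * s)] makes the derivative of [h] nonnegative on the half-line,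
    and the mean value theorem compares [h t] with [h 0]. *)
Lemma linear_ode_ge0 v w a :
  (forall t, is_derive t (1 : R) v (- a * v t + w t)) ->
  (forall t, 0 <= t -> 0 <= w t) -> 0 <= v 0 -> forall t, 0 <= t -> 0 <= v t.
Proof.
move=> dv w0 v0 t; rewrite le_eqVlt => /predU1P[<-//|t0].
pose h s := expR (a * s) * v s.
have dh s : is_derive s (1 : R) h (expR (a * s) * w s).
  have := is_deriveM (is_derive_expRM a s) (dv s).
  by move/is_derive_eq; apply; rewrite /GRing.scale/=; ring.
have ch : {within `[0, t], continuous h}.
  by apply: continuous_subspaceT; exact: continuous_is_derive dh.
have [s] := MVT t0 (fun s _ => dh s) ch; rewrite in_itv/= => /andP[s0 _].
rewrite subr0 {2}/h mulr0 expR0 mul1r => /eqP; rewrite subr_eq => /eqP hE.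
have : 0 <= h t.
  by rewrite hE addr_ge0// !mulr_ge0 ?expR_ge0 ?w0// ltW.
by rewrite /h pmulr_rge0// expR_gt0.
Qed.

(** The function [D * expR (- b * t)] is a supersolution: [D] is at least [C0], and [D * (a - b)] is
    at least [C]. Its difference with [v] falls under [linear_ode_ge0]. *)
Lemma linear_ode_le_exp v w a b C0 C : b < a -> 0 <= C0 -> 0 <= C ->
  (forall t, is_derive t (1 : R) v (- a * v t + w t)) ->
  (forall t, 0 <= t -> w t <= C * expR (- b * t)) -> v 0 <= C0 ->
  forall t, 0 <= t -> v t <= (C0 + C / (a - b)) * expR (- b * t).
Proof.
move=> ba C00 C_0 dv wC v0 t t0; rewrite -subr_ge0.
have ab0 : 0 < a - b by rewrite subr_gt0.
set D := C0 + _.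
apply: (@linear_ode_ge0 (fun t => D * expR (- b * t) - v t)
  (fun t => D * (a - b) * expR (- b * t) - w t) a) => //.
- move=> s; have := is_deriveB (is_deriveZ D (is_derive_expRM (- b) s)) (dv s).
  by move/is_derive_eq; apply; rewrite /GRing.scale/=; ring.
- move=> s s0; rewrite subr_ge0 (le_trans (wC _ s0))// ler_wpM2r ?expR_ge0//.
  by rewrite /D mulrDl divfK ?gt_eqF// lerDr mulr_ge0// ltW.
- by rewrite mulr0 expR0 mulr1 subr_ge0 (le_trans v0)// lerDl divr_ge0// ltW.
Qed.

Lemma cvg_expRMN c : 0 < c -> expR (- c * t) @[t --> +oo] --> (0 : R).
Proof.
move=> c0.
have -> : (fun t => expR (- c * t)) = (fun t => expR (- t)) \o ( *%R c).
  by apply/funext => t /=; rewrite mulNr.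
apply: (@cvg_comp _ _ _ ( *%R c) (fun t => expR (- t)) _ (pinfty_nbhs R)).
  by apply: gt0_cvgMry => //; exact: cvg_id.
exact: cvgr_expR.
Qed.

Lemma FTC_itv0y F f (l : R) :
  (forall t, 0 <= t -> 0 <= f t) -> (forall t, is_derive t (1 : R) F (f t)) ->
  continuous f -> F t @[t --> +oo] --> l ->
  (\int[mu]_(t in `[0%R, +oo[) (f t)%:E = l%:E - (F 0)%:E)%E.
Proof.
move=> f0 dF cf Fl; apply: ge0_continuous_FTC2y => //.
- exact: continuous_subspaceT.
- by apply: cvg_at_right_filter; exact: (continuous_is_derive dF).
- by move=> t _; rewrite derive1E; have [_ ->] := dF t.
Qed.

Lemma measurable_itv0y f : continuous f ->
  measurable_fun (`[0%R, +oo[%classic : set R) (EFin \o f).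
Proof.
move=> cf; apply/measurable_EFinP; apply: measurable_funTS.
exact: continuous_measurable_fun.
Qed.

Section ExponentialDecay.
Variables (f : R -> R) (D c : R).
Hypotheses (c0 : 0 < c) (cf : continuous f).
Hypothesis fD : forall t, 0 <= t -> `|f t| <= D * expR (- c * t).

Let e t := D * expR (- c * t).
(** The antiderivative of [e] that vanishes at infinity. *)
Let E t := - (D / c) * expR (- c * t).

Let e_ge0 t : 0 <= e t.
Proof.
rewrite mulr_ge0 ?expR_ge0//.
by have := fD (lexx _); rewrite mulr0 expR0 mulr1; apply: le_trans.
Qed.

Let is_deriveE t : is_derive t (1 : R) E (e t).
Proof.
have := is_deriveZ (- (D / c)) (is_derive_expRM (- c) t).
move/is_derive_eq; apply; rewrite /GRing.scale/= /e; field.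
by rewrite gt_eqF.
Qed.

Let cvgE : E t @[t --> +oo] --> (0 : R).
Proof.
rewrite -(mulr0 (- (D / c))); apply: cvgM; first exact: cvg_cst.
exact: cvg_expRMN.
Qed.

Let continuous_e : continuous e.
Proof.
move=> t; apply: cvgM; first exact: cvg_cst.
exact: (continuous_is_derive (is_derive_expRM (- c))).
Qed.

Let integrable_e : mu.-integrable `[0, +oo[%classic (EFin \o e).
Proof.
apply/integrableP; split; first exact: measurable_itv0y.
under eq_integral do rewrite /= ger0_norm//.
by rewrite (FTC_itv0y _ is_deriveE continuous_e cvgE)// -EFinB ltry.
Qed.

Lemma exp_decay_integrable : mu.-integrable `[0, +oo[%classic (EFin \o f).
Proof.
apply: le_integrable integrable_e => //; first exact: measurable_itv0y.
move=> t /=; rewrite in_itv/= andbT => t0.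
by rewrite lee_fin [leRHS]ger0_norm// fD.
Qed.

(* Adding the integrable majorant [e] makes the integrand nonnegative, as the
   library's fundamental theorem on half-lines requires. *)
Lemma exp_decay_FTC F (l : R) : (forall t, is_derive t (1 : R) F (f t)) ->
  F t @[t --> +oo] --> l -> \int[mu]_(t in `[0, +oo[) f t = l - F 0.
Proof.
move=> dF Fl.
have : \int[mu]_(t in `[0, +oo[) (f t + e t) = (l + 0) - (F 0 + E 0).
  have dFE t : is_derive t (1 : R) (F \+ E) (f t + e t).
    exact: (is_deriveD (dF t) (is_deriveE t)).
  rewrite /Rintegral (FTC_itv0y _ dFE (l := l + 0))//.
  - move=> t t0; rewrite -lerBlDr sub0r.
    by have := fD t0; rewrite ler_norml => /andP[].
  - by move=> t; apply: cvgD; [exact: cf|exact: continuous_e].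
  - exact: cvgD.
rewrite RintegralD//; last exact: exp_decay_integrable.
have -> : \int[mu]_(t in `[0, +oo[) e t = 0 - E 0.
  by rewrite /Rintegral (FTC_itv0y _ is_deriveE continuous_e cvgE).
by lra.
Qed.

End ExponentialDecay.

End Decay.

(** * Positive semidefinite and positive definite matrices *)

Section PositiveDefinite.
Context {R : realFieldType} {n : nat}.
Implicit Types (S : 'M[R]_n) (v w : 'rV[R]_n).

Lemma qformE S v : qform S v = \sum_a \sum_b v 0 a * v 0 b * S a b.
Proof.
rewrite /qform mxE exchange_big; apply: eq_bigr => b _.
by rewrite !mxE mulr_suml; apply: eq_bigr => a _; rewrite mulrAC.
Qed.

Lemma row_sqnorm_eq0 v : (v *m v^T) 0 0 = 0 -> v = 0.
Proof.
rewrite mxE => /eqP; rewrite psumr_eq0 => [/allP v0|i _]; last first.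
  by rewrite mxE -expr2 sqr_ge0.
apply/rowP => i; have := v0 i (mem_index_enum _).
by rewrite !mxE -expr2 sqrf_eq0 => /eqP.
Qed.

(** Perturbing [v] by [t] times [w = v *m S] changes the form to [2 * t * B + t ^+ 2 * q], with [B]
    the squared norm of [w]; a small negative [t] would make this negative unless [B = 0]. *)
Lemma semiposdef_ker S v : S^T = S -> (forall w, 0 <= qform S w) ->
  qform S v = 0 -> v *m S = 0.
Proof.
move=> sS S0 v0; apply: row_sqnorm_eq0.
set B := _ 0 0; pose w := v *m S; set q := qform S w.
have qE t : qform S (v + t *: w) = 2 * t * B + t ^+ 2 * q.
  have wv : (w *m S *m v^T) 0 0 = B.
    by rewrite -mulmxA -{1}sS -trmx_mul.
  rewrite /qform linearD linearZ/= !mulmxDl !mulmxDr -!scalemxAl -!scalemxAr.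
  have := v0; have : (v *m S *m w^T) 0 0 = B by [].
  have : (w *m S *m w^T) 0 0 = q by []; move: wv; rewrite /qform.
  move: (v *m S *m v^T) (v *m S *m w^T) (w *m S *m v^T) (w *m S *m w^T).
  by move=> X1 X2 X3 X4 h3 h4 h2 h1; rewrite !mxE h1 h2 h3 h4; ring.
have q0 : 0 <= q := S0 w.
have q1 : 0 < q + 1 by rewrite ltr_wpDl.
(* The denominator [q + 1], instead of the minimizing [q], covers the case [q = 0]. *)
have := S0 (v + (- B / (q + 1)) *: w); rewrite qE.
rewrite (_ : _ + _ = - (B ^+ 2 * ((q + 2) / (q + 1) ^+ 2))); last first.
  by field; rewrite gt_eqF.
rewrite oppr_ge0 pmulr_lle0; last by rewrite divr_gt0 ?exprn_gt0// ltr_wpDl.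
by move=> B2; apply/eqP; rewrite -sqrf_eq0 eq_le B2 sqr_ge0.
Qed.

Lemma posdef_unit S : posdef S -> S \in unitmx.
Proof. by move=> /posdef_det_gt0 S0; rewrite unitmxE unitfE gt_eqF. Qed.

(** The substitution of [v *m invmx S] for [v] carries one form into the other. *)
Lemma posdef_inv S : posdef S -> posdef (invmx S).
Proof.
move=> Spd; have uS := posdef_unit Spd; have [sS S0] := Spd.
split; first by rewrite trmx_inv sS.
move=> v v0; have -> : qform (invmx S) v = qform S (v *m invmx S).
  by rewrite /qform mulmxKV// trmx_mul trmx_inv sS mulmxA.
apply: S0; apply: contraNneq v0 => vS.
by rewrite -[v](mulmxKV uS) vS mul0mx.
Qed.

End PositiveDefinite.
Lemma Rintegral_sum {d} {T : measurableType d} {R : realType}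
    (mu : {measure set T -> \bar R}) (D : set T) (I : Type) (r : seq I)
    (f : I -> T -> R) : measurable D ->
  (forall i, mu.-integrable D (EFin \o f i)) ->
  Rintegral mu D (fun x => \sum_(i <- r) f i x) =
  \sum_(i <- r) Rintegral mu D (f i).
Proof.
move=> mD intf; elim: r => [|i r IHr].
  by rewrite big_nil; under eq_Rintegral do rewrite big_nil; rewrite Rintegral_cst ?mul0r.
rewrite big_cons -IHr -RintegralD//; last first.
  rewrite (_ : _ \o _ = fun x => \sum_(j <- r) (f j x)%:E)%E; last first.
    by apply/funext => x /=; rewrite sumEFin.
  by apply: integrable_sum => // k _; exact: intf.
by apply: eq_Rintegral => x _; rewrite big_cons.
Qed.

(** * The covariance matrix *)

Section Covariance.
Context {R : realType} {K : nat}.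
Variables (hK : (0 < K)%N) (alpha : 'I_K -> R).
Hypothesis alpha_gt0 : forall k, 0 < alpha k.
Local Notation mu := (@lebesgue_measure R).
Local Notation A := (drift_mx alpha).
Local Notation last := (idx_last hK).

Let u k t := expmx (t *: A) k last.

Let u0 k : u k 0 = (k == last)%:R.
Proof. by rewrite /u expmx0 mxE. Qed.

Let is_derive_u k t :
  is_derive t (1 : R) (u k) (\sum_l A k l * u l t).
Proof. by have := is_derive_expmx A t k last; rewrite mxE. Qed.

Lemma covariance_integrandE t i j :
  covariance_integrand hK A t i j = u i t * u j t.
Proof.
rewrite /covariance_integrand -trmx_expmx -colE -mulmxA trmx_delta -rowE.
by rewrite mxE big_ord_recl big_ord0 addr0 !mxE.
Qed.

(** The remaining sum has one term, or none when [k] is the last index; this form avoids a case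
    distinction on [k]. *)
Lemma drift_mx_sum k (x : 'I_K -> R) :
  \sum_l A k l * x l = - alpha k * x k + \sum_(l < K | l == k.+1 :> nat) x l.
Proof.
rewrite (bigD1 k)//= mxE eqxx; congr (_ + _).
rewrite [RHS]big_mkcond [RHS](bigD1 k)//= ltn_eqF// add0r.
by apply: eq_bigr => l lk; rewrite mxE (negbTE lk); case: ifP; rewrite ?mul1r ?mul0r.
Qed.

(** The system is solved from the last component upwards: each [u k] obeys a scalar linear equation
    forced by the next component, so [linear_ode_ge0] and [linear_ode_le_exp] propagate both
    bounds. *)
Lemma expmx_drift_decay : exists b C : R, [/\ 0 < b, 0 <= C &
  forall k t, 0 <= t -> 0 <= u k t <= C * expR (- b * t)].
Proof.
(* Half the smallest rate is strictly below every [alpha k], as [linear_ode_le_exp] requires; the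
   gap absorbs the polynomial factors that coinciding rates produce. *)
have [b b0 b_lt] : exists2 b : R, 0 < b & forall k, b < alpha k.
  have [k _ kmin] := @arg_minP _ _ _ last xpredT alpha isT.
  exists (alpha k / 2); first by rewrite divr_gt0.
  move=> l; apply: lt_le_trans (kmin l isT).
  by rewrite ltr_pdivrMr// ltr_pMr// ltr1n.
have decay k : exists C, 0 <= C /\
    forall t, 0 <= t -> 0 <= u k t <= C * expR (- b * t).
  have [m] := ubnP (K - k); elim: m k => // m IHm k; rewrite ltnS => Km.
  have [C [C0 wC]] : exists C, 0 <= C /\ forall t, 0 <= t ->
      0 <= \sum_(l < K | l == k.+1 :> nat) u l t <= C * expR (- b * t).
    have [kK|Kk] := ltnP k.+1 K.
      have [|C [C0 uC]] := IHm (Ordinal kK).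
        by rewrite (leq_trans _ Km)// ltn_sub2l.
      exists C; split => // t /uC.
      by rewrite (big_pred1 (Ordinal kK)).
    (* The last component has no forcing term. *)
    exists 0; split => // t _; rewrite mul0r big_pred0 ?lexx// => l.
    by apply: contraTF Kk => /eqP <-; rewrite -ltnNge.
  have du t : is_derive t (1 : R) (u k)
      (- alpha k * u k t + \sum_(l < K | l == k.+1 :> nat) u l t).
    by rewrite -drift_mx_sum.
  exists (1 + C / (alpha k - b)); split.
    by rewrite addr_ge0// divr_ge0// subr_ge0 ltW.
  move=> t t0; apply/andP; split.
    apply: (linear_ode_ge0 du) t0; first by move=> s /wC/andP[].
    by rewrite u0.
  apply: (linear_ode_le_exp (b_lt k) ler01 C0 du) t0 => [s /wC/andP[]//|].
  by rewrite u0 lern1 leq_b1.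
have [C uC] := fin_all_exists decay.
have C0 k : 0 <= C k by have [] := uC k.
exists b, (\sum_k C k); split => //; first exact: sumr_ge0.
move=> k t t0; have [_ /(_ t t0)/andP[-> /le_trans]] := uC k; apply.
by rewrite ler_wpM2r ?expR_ge0// (bigD1 k)//= lerDl sumr_ge0.
Qed.

(** * Lyapunov equation and positive definiteness of the covariance *)

Let cov i j := \int[mu]_(t in `[0, +oo[) (u i t * u j t).

Let continuous_uu i j : continuous (fun t => u i t * u j t).
Proof.
move=> t; apply: cvgM.
  exact: (continuous_is_derive (is_derive_u i)).
exact: (continuous_is_derive (is_derive_u j)).
Qed.

Let uu_decay : exists b D : R, 0 < b /\
  forall i j t, 0 <= t -> `|u i t * u j t| <= D * expR (- b * t).
Proof.
have [b [C [b0 C0 uC]]] := expmx_drift_decay.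
exists (b + b), (C * C); split; first exact: addr_gt0.
move=> i j t t0; have /andP[ui uiC] := uC i _ t0; have /andP[uj ujC] := uC j _ t0.
by rewrite ger0_norm ?mulr_ge0// opprD mulrDl expRD mulrACA ler_pM.
Qed.

Let uu_integrable i j :
  mu.-integrable `[0, +oo[%classic (fun t => (u i t * u j t)%:E).
Proof.
have [b [D [b0 uuD]]] := uu_decay.
exact: (exp_decay_integrable b0 (@continuous_uu i j) (uuD i j)).
Qed.

Lemma covariance_integrable i j : mu.-integrable `[0, +oo[%classic
  (fun t => (covariance_integrand hK A t i j)%:E).
Proof.
rewrite (_ : (fun t => _) = fun t => (u i t * u j t)%:E); first exact: uu_integrable.
by apply/funext => t; rewrite covariance_integrandE.
Qed.

Let quad_integrable (c : 'I_K -> 'I_K -> R) i j :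
  mu.-integrable `[0, +oo[%classic (EFin \o (fun t => c i j * (u i t * u j t))).
Proof.
rewrite (_ : _ \o _ = fun t => (c i j)%:E * (u i t * u j t)%:E)%E//.
by apply: integrableZl => //; exact: uu_integrable.
Qed.

(** Serves both the Lyapunov equation, with [c] built from [A], and semidefiniteness, with
    [c a b = v 0 a * v 0 b]. *)
Let integral_quad (c : 'I_K -> 'I_K -> R) :
  \int[mu]_(t in `[0, +oo[) (\sum_i \sum_j c i j * (u i t * u j t)) =
  \sum_i \sum_j c i j * cov i j.
Proof.
under eq_Rintegral do rewrite pair_bigA.
rewrite Rintegral_sum//.
rewrite [RHS]pair_bigA; apply: eq_bigr => -[i j] _ /=.
by rewrite RintegralZl//; exact: uu_integrable.
Qed.

(** Brings entry [(i, j)] of [A x + x A^T] into the shape of one double sum in [x], as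
    [integral_quad] requires. *)
Let lyapunov_sum i j (x : 'I_K -> 'I_K -> R) :
  \sum_a \sum_b (A i a * (b == j)%:R + (a == i)%:R * A j b) * x a b =
  \sum_a A i a * x a j + \sum_b A j b * x i b.
Proof.
under eq_bigr do (under eq_bigr do rewrite mulrDl; rewrite big_split/=).
rewrite big_split/=; congr (_ + _).
  apply: eq_bigr => a _; rewrite (bigD1 j)//= eqxx mulr1 big1 ?addr0// => b bj.
  by rewrite (negbTE bj) mulr0 mul0r.
rewrite [LHS](bigD1 i)//= [X in _ + X]big1 ?addr0 => [|a ai]; last first.
  by rewrite big1// => b _; rewrite (negbTE ai) !mul0r.
by apply: eq_bigr => b _; rewrite eqxx mul1r.
Qed.

(** The left side is the integral of the derivative of [u i t * u j t], a product that vanishes at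
    infinity and starts from the entry of [e_K e_K^T]. *)
Let cov_lyapunov i j :
  \sum_a A i a * cov a j + \sum_b A j b * cov i b =
  - ((i == last) && (j == last))%:R.
Proof.
pose c a b := A i a * (b == j)%:R + (a == i)%:R * A j b.
rewrite -lyapunov_sum -(integral_quad c).
have [b [D [b0 uuD]]] := uu_decay.
have fE t : \sum_a \sum_b c a b * (u a t * u b t) =
    u i t * (\sum_l A j l * u l t) + u j t * (\sum_l A i l * u l t).
  rewrite (lyapunov_sum i j (fun a b => u a t * u b t)) addrC !mulr_sumr.
  by congr (_ + _); apply: eq_bigr => l _; ring.
have dF t : is_derive t (1 : R) (fun t => u i t * u j t)
    (\sum_a \sum_b c a b * (u a t * u b t)).
  rewrite fE; exact: (is_deriveM (is_derive_u i t) (is_derive_u j t)).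
have cf : continuous (fun t => \sum_a \sum_b c a b * (u a t * u b t)).
  apply: continuous_big => [|a _]; first exact: add_continuous.
  apply: continuous_big => [|a' _]; first exact: add_continuous.
  by move=> t; apply: cvgM; [exact: cvg_cst|exact: continuous_uu].
have fD t : 0 <= t -> `|\sum_a \sum_b c a b * (u a t * u b t)| <=
    (\sum_a \sum_b `|c a b| * D) * expR (- b * t).
  move=> t0; rewrite (le_trans (ler_norm_sum _ _ _))// mulr_suml ler_sum// => a _.
  rewrite (le_trans (ler_norm_sum _ _ _))// mulr_suml ler_sum// => a' _.
  by rewrite normrM -mulrA ler_wpM2l// uuD.
have Fl : u i t * u j t @[t --> +oo] --> (0 : R).
  apply/norm_cvg0P.
  apply: (@squeeze_cvgr _ _ _ _ (cst 0) (fun t => D * expR (- b * t))).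
  - near=> t; rewrite normr_ge0 uuD//.
  - exact: cvg_cst.
  - rewrite -(mulr0 D); apply: cvgM; [exact: cvg_cst|exact: cvg_expRMN].
rewrite (exp_decay_FTC b0 cf fD dF Fl) !u0 sub0r.
by case: eqP; case: eqP; rewrite ?mulr1 ?mulr0.
Unshelve. all: by end_near. Qed.

Lemma covariance_mxE g i j : covariance_mx hK A g i j = g ^+ 2 * cov i j.
Proof.
rewrite !mxE; congr (_ * _); apply: eq_Rintegral => t _.
exact: covariance_integrandE.
Qed.

Lemma covariance_lyapunov g :
  A *m covariance_mx hK A g + covariance_mx hK A g *m A^T =
  - (g ^+ 2 *: delta_mx last last).
Proof.
apply/matrixP => i j; rewrite !mxE -mulrN -cov_lyapunov mulrDr !mulr_sumr.
congr (_ + _); apply: eq_bigr => l _; rewrite covariance_mxE ?mxE; last by ring.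
by rewrite mulrCA.
Qed.

(* Controllability: the left kernel of [S] is invariant under [A] and lies in
   the hyperplane orthogonal to [e_K]. *)
Lemma lyapunov_ker (c : R) (S : 'M[R]_K) : 0 < c -> S^T = S ->
  A *m S + S *m A^T = - (c *: delta_mx last last) ->
  forall v : 'rV[R]_K, v *m S = 0 -> v = 0.
Proof.
move=> c0 sS lyapS.
have ker_step (v : 'rV[R]_K) : v *m S = 0 -> v 0 last = 0 /\ v *m A *m S = 0.
  move=> vS; have Sv : S *m v^T = 0 by rewrite -sS -trmx_mul vS linear0.
  have := congr1 (mulmx v) lyapS.
  rewrite mulmxDr !mulmxA vS mul0mx addr0 mulmxN -scalemxAr => vAS.
  (* Multiplying further by [v^T] on the right leaves [c * v 0 last ^+ 2 = 0]. *)
  have v_last : v 0 last = 0.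
    move/(congr1 (fun M => (M *m v^T) 0 0)): (vAS).
    rewrite /= -mulmxA Sv mulmx0 mxE mulNmx -scalemxAl.
    rewrite -[delta_mx _ _](mul_delta_mx (0 : 'I_1)) mulmxA -colE -mulmxA -rowE.
    rewrite !mxE big_ord_recl big_ord0 addr0 !mxE => /esym/eqP.
    rewrite oppr_eq0 mulf_eq0 gt_eqF//= -expr2 sqrf_eq0 => /eqP //.
  split => //; rewrite vAS -[delta_mx _ _](mul_delta_mx (0 : 'I_1)) mulmxA -colE.
  rewrite (_ : col last v = 0) ?mul0mx ?scaler0 ?oppr0//.
  by apply/matrixP => i j; rewrite !ord1 !mxE v_last.
move=> v vS; apply/rowP => j; rewrite mxE.
(* Induction from the last index down, for all kernel vectors at once, because the induction
   hypothesis is applied to [v *m A] as well as to [v]. *)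
have [m] := ubnP (K - j.+1); elim: m j v vS => // m IHm j v vS.
rewrite ltnS => Kj.
have [jK|Kj1] := ltnP j.+1 K; last first.
  suff -> : j = last by have [] := ker_step _ vS.
  apply/val_inj => /=; rewrite subn1; apply/eqP.
  by rewrite eqn_leq -ltnS prednK// ltn_ord/= -ltnS prednK.
have Kj' : (K - (Ordinal jK).+1 < m)%N by rewrite (leq_trans _ Kj)// ltn_sub2l.
(* Entry [j.+1] of [v *m A] is [v 0 j] minus a multiple of entry [j.+1] of [v]; both entries at
   [j.+1] vanish by induction. *)
have := IHm _ _ (ker_step _ vS).2 Kj'.
rewrite mxE (bigD1 (Ordinal jK))//= (IHm _ _ vS Kj') mul0r add0r.
rewrite (bigD1 j)/=; last by rewrite -val_eqE/= ltn_eqF.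
rewrite big1 ?addr0 => [|i /andP[ij1 ij]]; last first.
  rewrite mxE eq_sym (negbTE ij1) (_ : (_ == _) = false) ?mulr0//.
  by apply: contraNF ij => /eqP[] /val_inj ->.
by rewrite mxE -val_eqE/= gtn_eqF// eqxx mulr1.
Qed.

(** The form is [g ^+ 2] times the integral of a square, hence nonnegative; a vector on which it
    vanishes lies in the kernel, which [lyapunov_ker] shows to be trivial. *)
Lemma covariance_posdef g : 0 < g -> posdef (covariance_mx hK A g).
Proof.
move=> g0; set S := covariance_mx _ _ _.
have g20 : 0 < g ^+ 2 by rewrite exprn_gt0.
have sS : S^T = S.
  apply/matrixP => i j; rewrite mxE !covariance_mxE; congr (_ * _).
  by apply: eq_Rintegral => t _; rewrite mulrC.
have S0 v : 0 <= qform S v.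
  have -> : qform S v = g ^+ 2 * \sum_a \sum_b v 0 a * v 0 b * cov a b.
    rewrite qformE mulr_sumr; apply: eq_bigr => a _; rewrite mulr_sumr.
    by apply: eq_bigr => b _; rewrite covariance_mxE mulrCA.
  rewrite mulr_ge0 ?sqr_ge0// -(integral_quad (fun a b => v 0 a * v 0 b)).
  apply: Rintegral_ge0 => t _.
  rewrite (_ : \sum_a _ = (\sum_a v 0 a * u a t) ^+ 2) ?sqr_ge0//.
  rewrite expr2 mulr_suml; apply: eq_bigr => a _; rewrite mulr_sumr.
  by apply: eq_bigr => b _; rewrite mulrACA.
have ker0 := lyapunov_ker g20 sS (covariance_lyapunov g).
split => // v v0; rewrite lt_neqAle S0 andbT eq_sym.
by apply: contraNneq v0 => /(semiposdef_ker sS S0)/ker0 ->.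
Qed.

(** * Closed form of the covariance for equal rates *)

(** With [p] and [q] the distances to the last index, this is the binomial coefficient [p + q]
    choose [p], times [g ^+ 2 / (2 * a) ^+ (p + q + 1)]. *)
Let gcoef (g a : R) p q : R :=
  g ^+ 2 * (p + q)`!%:R / (p`!%:R * q`!%:R * (2 * a) ^+ (p + q + 1)).

Let gcoef00 g a : 0 < a -> 2 * a * gcoef g a 0 0 = g ^+ 2.
Proof. by move=> a0; rewrite /gcoef !fact0 expr1; field; rewrite gt_eqF. Qed.

Let gcoef0S g a q : 0 < a -> 2 * a * gcoef g a 0 q.+1 = gcoef g a 0 q.
Proof.
move=> a0; rewrite /gcoef !add0n fact0 !addn1 !exprS; field.
by rewrite expf_neq0 ?mulf_neq0 ?(lt0r_neq0 a0) ?pnatr_eq0 -?lt0n ?fact_gt0.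
Qed.

Let gcoefC g a p q : gcoef g a p q = gcoef g a q p.
Proof. by rewrite /gcoef addnC [X in X * _ ^+ _]mulrC. Qed.

(** Pascal's rule for the binomial coefficient [p + q + 2] choose [p + 1]. *)
Let gcoefSS g a p q : 0 < a ->
  2 * a * gcoef g a p.+1 q.+1 = gcoef g a p q.+1 + gcoef g a p.+1 q.
Proof.
move=> a0; rewrite /gcoef !addSn !addnS !factS !addn0 !exprS !natrM; field.
by rewrite expf_neq0 ?mulf_neq0 ?(lt0r_neq0 a0) ?nat1r ?pnatr_eq0 -?lt0n ?fact_gt0.
Qed.

(** The Lyapunov equation determines each entry from those closer to the last row and column;
    [gcoef] obeys the same recursion with the same corner value. *)
Lemma covariance_const g a : 0 < a -> (forall k, alpha k = a) ->
  forall i j : 'I_K, covariance_mx hK A g i j =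
    g ^+ 2 * ((2 * K - i.+1 - j.+1)`!)%:R
      / (((K - i.+1)`!)%:R * ((K - j.+1)`!)%:R
         * (2 * a) ^+ (2 * K - i.+1 - j.+1 + 1)).
Proof.
move=> a0 alphaE i j.
(* No truncation occurs, since [i.+1] and [j.+1] are at most [K]. *)
have -> : (2 * K - i.+1 - j.+1 = (K - i.+1) + (K - j.+1))%N.
  by have := ltn_ord i; have := ltn_ord j; lia.
rewrite -[RHS]/(gcoef g a (K - i.+1) (K - j.+1)).
set S := covariance_mx hK A g.
(* The two diagonal entries of [A] contribute [- 2 * a * S k l] to the Lyapunov equation; each sum
   is empty when its index is the last one. *)
have rec k l : 2 * a * S k l = g ^+ 2 * ((k == last) && (l == last))%:R +
    (\sum_(m < K | m == k.+1 :> nat) S m l +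
     \sum_(m < K | m == l.+1 :> nat) S k m).
  have := cov_lyapunov k l; rewrite !drift_mx_sum !alphaE.
  move/(congr1 ( *%R (g ^+ 2))).
  rewrite /S covariance_mxE (eq_bigr _ (fun m _ => covariance_mxE g m l)).
  rewrite (eq_bigr _ (fun m _ => covariance_mxE g k m)).
  by rewrite -!mulr_sumr; lra.
have lastE k : (k == last) = (k.+1 == K).
  by rewrite -val_eqE/= -eqSS; congr (_ == _); rewrite subn1 prednK.
have sumE k (x : 'I_K -> R) (kK : (k.+1 < K)%N) :
    \sum_(m < K | m == k.+1 :> nat) x m = x (Ordinal kK).
  by rewrite (big_pred1 (Ordinal kK)).
have sum0 k (x : 'I_K -> R) : k.+1 = K -> \sum_(m < K | m == k.+1 :> nat) x m = 0.
  by move=> kK; rewrite big_pred0// => m; rewrite kK ltn_eqF.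
have a20 : 2 * a != 0 by rewrite mulf_neq0// gt_eqF.
have [n] := ubnP ((K - i.+1) + (K - j.+1)); elim: n i j => // n IHn i j ijn.
apply: (mulfI a20); rewrite rec !lastE.
have subE (k : 'I_K) : (k.+1 < K -> K - k.+1 = (K - k.+2).+1)%N.
  by move=> ?; rewrite subnSK.
have [iK|/ltn_geF iK|iK] := ltngtP i.+1 K; last 2 first.
- by rewrite ltn_ord in iK.
- have [jK|/ltn_geF jK|jK] := ltngtP j.+1 K; last 2 first.
  + by rewrite ltn_ord in jK.
  + by rewrite !sum0// iK jK subnn gcoef00// mulr1 !addr0.
  rewrite (sum0 i)// (sumE _ _ jK) IHn/=; last first.
    by move: ijn; rewrite (subE j)// addnS ltnS.
  by rewrite (subE j)// iK subnn gcoef0S// mulr0 !add0r.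
have [jK|/ltn_geF jK|jK] := ltngtP j.+1 K; last 2 first.
- by rewrite ltn_ord in jK.
- rewrite (sum0 j)// (sumE _ _ iK) IHn/=; last first.
    by move: ijn; rewrite (subE i)// addSn ltnS.
  by rewrite (subE i)// jK subnn ![gcoef _ _ _ 0]gcoefC gcoef0S// mulr0 add0r addr0.
rewrite (sumE _ _ iK) (sumE _ _ jK) !IHn/=; last 2 first.
- by move: ijn; rewrite (subE j)// addnS ltnS.
- by move: ijn; rewrite (subE i)// addSn ltnS.
by rewrite (subE i)// (subE j)// gcoefSS// mulr0 add0r.
Qed.

End Covariance.
(** * The steady state *)

(** Restriction to the line through [a] in direction [v] makes the rules for functions of one scalar
    variable available for directional derivatives. *)
Lemma is_derive_line (R : numFieldType) (V W : normedModType R) (f : V -> W) a v df :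
  is_derive (0 : R) (1 : R) (fun h => f (h *: v + a)) df -> is_derive a v f df.
Proof.
have E : (fun h : R => h^-1 *: (((fun h => f (h *: v + a)) \o shift 0) (h *: 1) -
      (fun h => f (h *: v + a)) 0)) =
    (fun h => h^-1 *: ((f \o shift a) (h *: v) - f a)).
  by apply/funext => h /=; rewrite addr0 scale0r add0r /GRing.scale/= mulr1.
move=> [dfa dE]; split.
  by move: dfa; rewrite /derivable E.
by rewrite -dE /derive E.
Qed.

Lemma mulmx_delta_entry (R : pzSemiRingType) n d (M : 'M[R]_n) k l :
  (M *m (delta_mx k l : 'M[R]_(n, d))) k l = M k k.
Proof.
rewrite mxE (bigD1 k)//= big1 ?addr0 => [|i ik]; first by rewrite mxE !eqxx mulr1.
by rewrite mxE (negbTE ik) mulr0.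
Qed.

Lemma mxtrace_delta (R : pzSemiRingType) n d k l (z : 'M[R]_(n, d)) :
  \tr ((delta_mx k l)^T *m z) = z k l.
Proof.
rewrite trmx_delta /mxtrace (bigD1 l)//= big1 ?addr0 => [|i il].
  rewrite mxE (bigD1 k)//= big1 ?addr0 => [|j jk]; first by rewrite mxE !eqxx mul1r.
  by rewrite mxE (negbTE jk) andbF mul0r.
by rewrite mxE big1// => j _; rewrite mxE (negbTE il) mul0r.
Qed.

Section GaussianDerivatives.
Context {R : realType} {n d : nat}.
Variables (P : 'M[R]_n) (C : R).
Hypothesis sP : P^T = P.
Implicit Types (y z : 'M[R]_(n, d)).

Definition colqform y := \sum_(l < d) qform P (col l y)^T.

Let f y := C * expR (- (1 / 2) * colqform y).

Lemma is_derive_mulmx_entry (M : 'M[R]_n) y k l :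
  is_derive y (delta_mx k l) (fun z => (M *m z) k l) (M k k).
Proof.
apply: is_derive_line.
have -> : (fun h : R => (M *m (h *: delta_mx k l + y)) k l) =
    (M k k \*o id) \+ cst ((M *m y) k l).
  by apply/funext => h; rewrite mulmxDr -scalemxAr mxE mxE mulmx_delta_entry /= mulrC.
have := is_deriveD (is_deriveZ (M k k) (is_derive_id (0 : R) (1 : R)))
  (is_derive_cst ((M *m y) k l) (0 : R) (1 : R)).
by move/is_derive_eq; apply; rewrite /GRing.scale/= mulr1 addr0.
Qed.

Lemma colqformE y : colqform y = \tr (y^T *m P *m y).
Proof.
apply: eq_bigr => l _; rewrite /qform trmxK tr_col -row_mul.
by rewrite colE mulmxA -colE -row_mul 2!mxE.
Qed.

(** Both cross terms equal [h * (P *m y) k l] by the symmetry of [P]. *)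
Lemma colqform_line y k l h :
  colqform (h *: delta_mx k l + y) =
  colqform y + 2 * h * (P *m y) k l + h ^+ 2 * P k k.
Proof.
rewrite !colqformE [(_ + _)^T]linearD/= [(_ *: _)^T]linearZ/=.
rewrite !mulmxDl !mulmxDr -!scalemxAl -!scalemxAr.
rewrite !linearD !linearZ/= -(mxtrace_tr (y^T *m P *m delta_mx k l)).
rewrite !trmx_mul trmxK sP -!mulmxA !mxtrace_delta mulmx_delta_entry; ring.
Qed.


Lemma is_derive_gaussian y k l :
  is_derive y (delta_mx k l) f (- (P *m y) k l * f y).
Proof.
apply: is_derive_line; rewrite /f.
under eq_fun do rewrite colqform_line.
set b := (P *m y) k l; set q := colqform y; set p := P k k.
have dg : is_derive (0 : R) (1 : R)
    (fun h => - (1 / 2) * (q + 2 * h * b + h ^+ 2 * p)) (- b).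
  have -> : (fun h => - (1 / 2) * (q + 2 * h * b + h ^+ 2 * p)) =
     cst (- (1 / 2) * q) \+ ((- b) \*o id) \+ ((- (1 / 2) * p) \*o (id * id)).
    by apply/funext => h; rewrite [RHS]/= (_ : (id * id) h = h ^+ 2)//; field.
  apply: is_derive_eq.
  by rewrite /GRing.scale /=; ring.
have := is_deriveZ C (is_derive1_comp (is_derive_expR _) dg).
move/is_derive_eq; apply; rewrite /GRing.scale /= mulr0 mul0r expr0n mul0r !addr0.
by ring.
Qed.

End GaussianDerivatives.

(** * Trace and quadratic form of the Lyapunov equation after inversion *)

Section StationaryIdentity.
Context {R : realFieldType} {n d : nat}.
Variables (A S : 'M[R]_n) (c : R) (k0 : 'I_n).
Hypothesis Spd : posdef S.
Hypothesis lyapS : A *m S + S *m A^T = - (c *: delta_mx k0 k0).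
Local Notation P := (invmx S).

Let sP : P^T = P. Proof. by rewrite trmx_inv Spd.1. Qed.

Let lyapP : P *m A + A^T *m P = - (c *: (P *m delta_mx k0 k0 *m P)).
Proof.
have uS := posdef_unit Spd.
have := congr1 (fun M => P *m M *m P) lyapS.
rewrite /= mulmxDr mulmxDl !mulmxA mulVmx// mul1mx mulmxK// => ->.
by rewrite mulmxN mulNmx -scalemxAr -scalemxAl.
Qed.

(** After multiplication by [invmx S], each term on the left of the Lyapunov equation has trace
    [\tr A]. *)
Lemma lyapunov_trace : 2 * \tr A = - (c * P k0 k0).
Proof.
have uS := posdef_unit Spd.
have := congr1 (fun M => \tr (M *m P)) lyapS.
rewrite /= mulmxDl mxtraceD mulmxK// mxtrace_mulC mulmxA mulVmx// mul1mx.
rewrite mxtrace_tr mulNmx -scalemxAl linearN linearZ/=.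
rewrite -[X in X *m _]trmx_delta mxtrace_delta => <-; ring.
Qed.

(** After symmetrization, the left side is the trace of [y^T (P A + A^T P) y], to which [lyapP]
    applies. *)
Lemma lyapunov_quad (y : 'M[R]_(n, d)) :
  2 * \sum_k \sum_l (A *m y) k l * (P *m y) k l =
  - (c * \sum_l (P *m y) k0 l ^+ 2).
Proof.
have trE (X Y : 'M[R]_(n, d)) : \tr (X^T *m Y) = \sum_k \sum_l X k l * Y k l.
  rewrite exchange_big; apply: eq_bigr => l _; rewrite mxE.
  by apply: eq_bigr => k _; rewrite mxE.
rewrite -trE mulr_natl mulr2n -{1}mxtrace_tr !trmx_mul !trmxK sP -mxtraceD.
rewrite -!mulmxA -mulmxDr [P *m (A *m y)]mulmxA [A^T *m (P *m y)]mulmxA -mulmxDl lyapP.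
rewrite mulNmx mulmxN -scalemxAl -scalemxAr linearN linearZ/=; congr (- (c * _)).
rewrite !mulmxA (_ : y^T *m P = (P *m y)^T); last by rewrite trmx_mul sP.
rewrite -!mulmxA trE (bigD1 k0)//= [X in _ + X]big1 ?addr0 => [|k kk0]; last first.
  rewrite big1// => l _; rewrite [X in _ * X]mxE big1 ?mulr0// => j _.
  by rewrite mxE (negbTE kk0) mul0r.
apply: eq_bigr => l _; rewrite expr2; congr (_ * _).
rewrite [LHS]mxE (bigD1 k0)//= big1 ?addr0 => [|j jk0].
  by rewrite [X in X * _]mxE !eqxx mul1r.
by rewrite [X in X * _]mxE (negbTE jk0) andbF mul0r.
Qed.

End StationaryIdentity.

(** * Total mass of the Gaussian *)

Section GaussianMass.
Context {R : realType} (d : nat) {K : nat}.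
Variable S : 'M[R]_K.
Hypothesis Spd : posdef S.

Definition gauss_norm : R :=
  ((2 * pi) `^ ((d * K)%:R / 2) * \det S `^ (d%:R / 2))^-1.

Lemma gaussianE (y : 'M[R]_(K, d)) :
  gaussian S y = gauss_norm * expR (- (1 / 2) * colqform (invmx S) y).
Proof.
rewrite /gaussian; congr (_ * expR (_ * _)).
by apply: eq_bigr => l _; rewrite /qform trmxK.
Qed.

(** Both real powers have positive bases and become square roots of integer powers, while
    [\det (invmx S)] is the inverse of [\det S]. *)
Lemma gauss_normK :
  gauss_norm * Num.sqrt ((2 * pi) ^+ (K * d) / \det (invmx S) ^+ d) = 1.
Proof.
have S0 := posdef_det_gt0 Spd.
have sqrtE (a : R) m : 0 < a -> a `^ (m%:R / 2) = Num.sqrt (a ^+ m).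
  move=> a0; rewrite powRrM powR_mulrn ?ltW// powR12_sqrt// ?exprn_ge0// ltW//.
have pi20 : 0 < 2 * pi :> R by rewrite mulr_gt0// pi_gt0.
rewrite /gauss_norm !sqrtE// det_inv exprVn invrK sqrtrM ?exprn_ge0 ?ltW//.
by rewrite mulnC mulVf// mulf_neq0// gt_eqF// sqrtr_gt0 exprn_gt0.
Qed.

Lemma measurable_gaussian_mx :
  measurable_fun [set: (K * d).-tuple (measurableTypeR R)]
    (fun t => (expR (- (1 / 2) *
      colqform (invmx S) (mx_of_tuple t : 'M[R]_(K, d))))%:E).
Proof.
rewrite (_ : (fun t => _) = fun t : (K * d).-tuple (measurableTypeR R) =>
    (expR (- (1 / 2) * qform (lin_mulmx (invmx S)) (row_of_tuple t)))%:E).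
  exact: measurable_gaussian.
by apply/funext => t; rewrite -mx_of_tupleK qform_lin_mulmx// (posdef_inv Spd).1.
Qed.

Lemma integral_gaussianT (rho0 : R) : 0 < rho0 ->
  (\int[lebesgue_tuple (K * d)]_t
    (rho0 * gaussian S (mx_of_tuple t : 'M[R]_(K, d)))%:E = rho0%:E)%E.
Proof.
move=> rho0_gt0; under eq_integral => t _ do rewrite gaussianE mulrA EFinM.
have c0 : 0 <= gauss_norm by rewrite invr_ge0 mulr_ge0// powR_ge0.
rewrite (ge0_integralZl _ measurableT measurable_gaussian_mx); last 2 first.
- by move=> t _; rewrite lee_fin expR_ge0.
- by rewrite lee_fin mulr_ge0// ltW.
rewrite (integral_gaussian_mx d (posdef_inv Spd)) -EFinM -mulrA gauss_normK.
by rewrite mulr1.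
Qed.

Lemma integrable_gaussianT (rho0 : R) : 0 < rho0 ->
  (lebesgue_tuple (K * d)).-integrable setT
    (fun t => (rho0 * gaussian S (mx_of_tuple t : 'M[R]_(K, d)))%:E).
Proof.
move=> rho0_gt0; have c0 : 0 <= gauss_norm by rewrite invr_ge0 mulr_ge0// powR_ge0.
apply/integrableP; split.
  under eq_fun do rewrite gaussianE mulrA EFinM.
  by apply: emeasurable_funM => //; exact: measurable_gaussian_mx.
under eq_integral => t _.
  rewrite gee0_abs; last first.
    by rewrite lee_fin gaussianE !mulr_ge0 ?expR_ge0 ?(ltW rho0_gt0).
  over.
by rewrite integral_gaussianT// ltry.
Qed.

Lemma density_gaussian (rho0 : R) : 0 < rho0 ->
  density (fun y : 'M[R]_(K, d) => rho0 * gaussian S y) = rho0.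
Proof. by move=> rho0_gt0; rewrite /density /Rintegral integral_gaussianT. Qed.

End GaussianMass.

Lemma measurable_Omega (R : realType) d : measurable (@Omega R d).
Proof.
rewrite (_ : @Omega R d = \bigcap_(i in [set: 'I_d])
    ((fun t : d.-tuple (measurableTypeR R) => tnth t i) @^-1` `]0, 1[%classic)).
  apply: fin_bigcap_measurable => // i _.
  by rewrite -[X in measurable X]setTI; exact: measurable_tnth.
by apply/seteqP; split => t /= H i; [move=> _|]; exact: H.
Qed.

(** * The Gaussian as a stationary solution *)

Section Steady.
Context {R : realType} {d K : nat}.
Variables (hK : (0 < K)%N) (A S : 'M[R]_K) (G : R -> R).
Variables (W : 'rV[R]_d -> R) (rho0 : R).
Hypotheses (hW : sensing_kernel W) (rho0_gt0 : 0 < rho0) (Spd : posdef S).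
Local Notation last := (idx_last hK).
Hypothesis lyapS : A *m S + S *m A^T = - (G rho0 ^+ 2 *: delta_mx last last).
Local Notation P := (invmx S).

Let f (y : 'M[R]_(K, d)) := rho0 * gaussian S y.

Let is_derive_f y k l :
  is_derive y (delta_mx k l) f (- (P *m y) k l * f y).
Proof.
have -> : f = fun y => rho0 * gauss_norm d S * expR (- (1 / 2) * colqform P y).
  by apply/funext => z; rewrite /f gaussianE mulrA.
exact/is_derive_gaussian/(posdef_inv Spd).1.
Qed.

Let is_derive_drift y k l :
  is_derive y (delta_mx k l) (fun z => (A *m z) k l * f z)
    ((A k k - (A *m y) k l * (P *m y) k l) * f y).
Proof.
have := is_deriveM (is_derive_mulmx_entry A y k l) (is_derive_f y k l).
by move/is_derive_eq; apply; rewrite /GRing.scale/=; ring.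
Qed.

Let derive_f k l : 'D_(delta_mx k l) f = fun y => - (P *m y) k l * f y.
Proof. by apply/funext => y; have [_ ->] := is_derive_f y k l. Qed.

Let is_derive2_f y k l :
  is_derive y (delta_mx k l) ('D_(delta_mx k l) f)
    (((P *m y) k l ^+ 2 - P k k) * f y).
Proof.
have dN : is_derive y (delta_mx k l) (fun z => - (P *m z) k l) (- P k k).
  exact: (is_deriveN (is_derive_mulmx_entry P y k l)).
rewrite derive_f; have := is_deriveM dN (is_derive_f y k l).
by move/is_derive_eq; apply; rewrite /GRing.scale/=; ring.
Qed.

(** The periodized kernel has unit mass, so the diffusion coefficient reduces to
    [G rho0 ^+ 2 / 2]. *)
Let torus_conv_const x : torus_conv (periodize W) (fun _ => rho0) x = rho0.
Proof.
rewrite /torus_conv RintegralZr ?(kernel_mass1 hW) ?mul1r//.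
- exact: measurable_Omega.
- exact: kernel_integrable.
Qed.

(** Nothing depends on time or position, so the transport side vanishes; drift and diffusion are
    multiples of [f] whose factors cancel by [lyapunov_trace] and [lyapunov_quad]. *)
Lemma gaussian_steady_state :
  steady_state hK A G (periodize W) (fun _ y => rho0 * gaussian S y).
Proof.
have fE : (fun y => rho0 * gaussian S y) = f by [].
split => /=.
- by [].
- by move=> t x _; exact: integrable_gaussianT.
- move=> t x _; under eq_fun do rewrite (density_gaussian d Spd rho0_gt0) EFinM.
  by apply: integrableZr; [exact: measurable_Omega|exact: kernel_integrable].
- by move=> *; exact: derivable_cst.
- by move=> *; exact: derivable_cst.
- by move=> t x y k l _; have [] := is_derive_drift y k l.
- by move=> t x y l _; have [] := is_derive_f y last l.
- by move=> t x y l _; have [] := is_derive2_f y last l.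
move=> t x y _; rewrite derive_cst add0r big1 => [|l _]; last by rewrite derive_cst mulr0.
set g := G rho0.
rewrite /VFP_operator (density_gaussian d Spd rho0_gt0) torus_conv_const.
have -> : \sum_(k < K) \sum_(l < d)
      'D_(delta_mx k l)
        (fun z : 'M[R]_(K, d) => (A *m z) k l * (rho0 * gaussian S z)) y =
    (d%:R * \tr A - \sum_k \sum_l (A *m y) k l * (P *m y) k l) * f y.
  rewrite mulrBl mulr_sumr !mulr_suml -sumrB; apply: eq_bigr => k _.
  rewrite mulr_suml -mulrA mulr_natl -[X in _ *+ X]card_ord -sumr_const -sumrB.
  apply: eq_bigr => l _; have [_ ->] := is_derive_drift y k l.
  by rewrite mulrBl.
have -> : \sum_(l < d) 'D_(delta_mx last l) ('D_(delta_mx last l) f) y =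
    (\sum_l (P *m y) last l ^+ 2 - d%:R * P last last) * f y.
  rewrite mulrBl mulr_suml -mulrA mulr_natl -[X in _ *+ X]card_ord -sumr_const -sumrB.
  apply: eq_bigr => l _; have [_ ->] := is_derive2_f y last l.
  by rewrite mulrBl.
have trA := lyapunov_trace Spd lyapS; have quadA := lyapunov_quad Spd lyapS y.
move: trA quadA; rewrite -/g.
set p := P last last; set X := \sum_k _; set Y := \sum_l _.
move=> trA quadA.
(* The trace identity cancels the terms constant in [y], the other identity those quadratic in
   [y]. *)
have -> : \tr A = - (g ^+ 2 * p) / 2 by lra.
have -> : X = - (g ^+ 2 * Y) / 2 by lra.
by field.
Qed.

End Steady.
Unset Implicit Arguments.

(** Since [Rintegral] and [invmx] are total, the integrability and the positive determinant certify
    that the covariance integral converges and that the inverse in the Gaussian is a genuine one.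
    Indices start at zero, so [i.+1] and [j.+1] are the mathematical ones. *)
Theorem lemma1 (R : realType) (d K : nat) (hd : (0 < d)%N) (hK : (0 < K)%N)
    (alpha : 'I_K -> R) (alpha_gt0 : forall k, 0 < alpha k)
    (G : R -> R) (hG : response_function G)
    (W : 'rV[R]_d -> R) (hW : sensing_kernel W)
    (rho0 : R) (rho0_gt0 : 0 < rho0) :
  let A := drift_mx alpha in
  let g0 := G rho0 in
  let Sigma := covariance_mx hK A g0 in
  [/\ 0 < g0,
      forall i j, (@lebesgue_measure R).-integrable `[0, +oo[%classic
        (fun t => (covariance_integrand hK A t i j)%:E),
      0 < \det Sigma,
      steady_state hK A G (periodize W) (fun _ y => rho0 * gaussian Sigma y) &
      forall a : R, 0 < a -> (forall k, alpha k = a) ->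
        forall i j : 'I_K,
          Sigma i j = g0 ^+ 2 * ((2 * K - i.+1 - j.+1)`!)%:R
            / (((K - i.+1)`!)%:R * ((K - j.+1)`!)%:R
               * (2 * a) ^+ (2 * K - i.+1 - j.+1 + 1)) ].
Proof.
move=> A g0 Sigma.
have g0_gt0 : 0 < g0 by apply: (response_gt0 hG); exact: ltW.
have Spd : posdef Sigma by exact: covariance_posdef.
split => //.
- by move=> i j; exact: covariance_integrable.
- exact: posdef_det_gt0.
- exact/gaussian_steady_state/covariance_lyapunov.
- by move=> a a0 alphaE i j; exact: covariance_const.
Qed.
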